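(* Let $q$ be a prime power and let $s\ge 2$ be an integer such that $q$ divides $s$ and $s\neq q$. Then there exist infinitely many integers $n$ for which there exists a co-edge-regular graph of level $4$ that is cospectral with the $s$-clique extension of each Latin Square graph $LS_{q+1}(qn)$.
   Context: Graphs are finite and simple; two graphs are cospectral if they have the same adjacency spectrum (with multiplicities). For adjacent vertices $x,y$, $\lambda(x,y)$ denotes the number of common neighbours of $x$ and $y$. A regular graph is co-edge-regular with parameter $\mu$ if any two distinct non-adjacent vertices have exactly $\mu$ common neighbours. A co-edge-regular graph has level $t$ if $\#\{\lambda(x,y)\mid x,y \text{ adjacent}\}=t$. Write $[N]=\{1,\dots,N\}$. An orthogonal array $OA(N,m)$ is an $m\times N^2$ array with entries in $[N]$ such that for any two distinct rows $r_i,r_j$ the pairs $(r_i(\ell),r_j(\ell))$, $\ell=1,\dots,N^2$, take $N^2$ different values. Given an $OA(N,m)$ with columns $c_1,\dots,c_{N^2}$, the associated Latin Square graph $LS_m(N)$ has vertex set $\{c_1,\dots,c_{N^2}\}$, with $c_i\sim c_j$ ($i\ne j$) iff there is an $\ell$ with $c_i(\ell)=c_j(\ell)$. (Every $LS_m(N)$ has spectrum $\{[(N-1)m]^1,[N-m]^{(N-1)m},[-m]^{(N-1)(N+1-m)}\}$.) The $s$-clique extension of a graph $G$ is obtained by replacing each vertex $x$ by a clique $\tilde X$ on $s$ vertices, where vertices from the cliques of distinct vertices $x,y$ are adjacent iff $x\sim y$ in $G$. *)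

(* Defs.v *)
From mathcomp Require Import all_boot all_order all_algebra all_field.

Set Implicit Arguments.
Unset Strict Implicit.
Unset Printing Implicit Defensive.

Import GRing.Theory.

Definition prime_power (q : nat) : Prop :=
  exists p k : nat, [/\ prime p, 0 < k & q = p ^ k].

Record sgraph := SGraph {
  svertex :> finType;
  adj : rel svertex;
  adj_sym : symmetric adj;
  adj_irr : irreflexive adj }.

Section Graphs.
Variable G : sgraph.
Implicit Types x y : G.

Definition common_nbrs x y : {set G} := [set z | adj x z & adj y z].

Definition regular : Prop :=
  exists k : nat, forall x, #|[set z | adj x z]| = k.

Definition co_edge_regular : Prop :=
  regular /\
  exists mu : nat, forall x y, x != y -> ~~ adj x y -> #|common_nbrs x y| = mu.

Definition lambda_values : seq nat :=
  [seq #|common_nbrs xy.1 xy.2| |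
    xy in [pred xy : G * G | adj xy.1 xy.2]].

Definition has_level (t : nat) : Prop := size (undup lambda_values) = t.

(* Adjacency eigenvalues are algebraic integers, so algC contains the whole
   spectrum. *)
Definition adj_mx : 'M[algC]_#|G| :=
  \matrix_(i, j) ((adj (enum_val i) (enum_val j))%:R)%R.

Definition eig_mult (a : algC) : nat := mup a (char_poly adj_mx).

End Graphs.

Definition cospectral (G H : sgraph) : Prop :=
  forall a : algC, eig_mult G a = eig_mult H a.

Definition orthogonal_array (N m : nat) (A : 'M['I_N]_(m, N ^ 2)) : Prop :=
  forall i j : 'I_m, i != j -> injective (fun l => (A i l, A j l)).

Section LatinSquareGraph.
Variables (N m : nat) (A : 'M['I_N]_(m, N ^ 2)).

(* The column c_l is represented by its index l; for an orthogonal array with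
   m >= 2 distinct indices give distinct columns. *)
Definition ls_adj : rel 'I_(N ^ 2) :=
  [rel c d | (c != d) && [exists l : 'I_m, A l c == A l d]].

Lemma ls_adj_sym : symmetric ls_adj.
Proof.
move=> c d; rewrite /ls_adj /= [c == d]eq_sym; congr (_ && _).
by apply: eq_existsb => l; exact: eq_sym.
Qed.

Lemma ls_adj_irr : irreflexive ls_adj.
Proof. by move=> c; rewrite /ls_adj /= eqxx. Qed.

Definition latin_square_graph : sgraph := SGraph ls_adj_sym ls_adj_irr.

End LatinSquareGraph.

Section CliqueExtension.
Variables (s : nat) (G : sgraph).

Definition ext_adj : rel (G * 'I_s) :=
  [rel u v | (u != v) && ((u.1 == v.1) || adj u.1 v.1)].

Lemma ext_adj_sym : symmetric ext_adj.
Proof. by move=> u v; rewrite /ext_adj /= [u == v]eq_sym [u.1 == _]eq_sym adj_sym. Qed.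

Lemma ext_adj_irr : irreflexive ext_adj.
Proof. by move=> u; rewrite /ext_adj /= eqxx. Qed.

Definition clique_extension : sgraph := SGraph ext_adj_sym ext_adj_irr.

End CliqueExtension.

(* Main.v *)
Require Import Defs.
From mathcomp Require Import all_boot all_order all_algebra all_field.
From mathcomp Require Import ring zify.

Set Implicit Arguments.
Unset Strict Implicit.
Unset Printing Implicit Defensive.

Import Order.TTheory GRing.Theory Num.Theory.

(* For an orthogonal array of index s with N symbols and q+1 rows, let R_j be the
   relation "equal entries in row j", and J the all-one matrix. If F is symmetric
   with diagonal q, R_j F = s q R_j and F^2 = s q F, then M := sum_j R_j - F satisfies
     M^2 = s q (q+1) J + s (N-2q) M + s (N-q) F   and   M F = s q M,
   so M is annihilated by a fixed polynomial with four distinct roots, and the traces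
   of M^0, ..., M^3 are determined; hence so are all eigenvalue multiplicities.
   The s-clique extension of LS_{q+1}(N) has A + I = M with F = q (I (x) J_s).
   A second solution with N = q n: take an array f of index s with q symbols on a set U
   (a conic in PG(2,q), each column repeated s/q times) and an array h of index 1 with n
   symbols on W. On U x W, with R_j "f_j and h_j agree" and F = (sum_j [f_j agrees] - J) (x) I,
   the matrix M is again a 0/1 matrix. The formula for M^2 shows that its graph is
   co-edge-regular, and that two distinct vertices with equal W-component have
   sq^2 - 2 + s(N-q)T common neighbours, T being the number of rows of f where they
   agree; adjacent vertices with different W-components behave as if T = 1. On a conic a
   line has 0, 1 or 2 points, and repeated columns give T = q+1: four values. *)

(** * Spectrum from an annihilating polynomial and traces *)

Section Spectrum.
Local Open Scope ring_scope.
Variable K : numFieldType.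

Lemma mup_prod_XsubC (I : Type) (r : seq I) (d : I -> K) a :
  mup a (\prod_(i <- r) ('X - (d i)%:P)) = count (fun i => d i == a) r.
Proof.
elim: r => [|i r IHr]; first by rewrite big_nil mupNroot // rootC oner_eq0.
rewrite big_cons mupM ?polyXsubC_eq0 //; last by apply/monic_neq0/monic_prod_XsubC.
by rewrite IHr /= -['X - _]expr1 mup_XsubCX; case: eqVneq.
Qed.

Lemma tr_horner_mx n (A : 'M[K]_n.+1) (p : {poly K}) m : (size p <= m)%N ->
  \tr (horner_mx A p) = \sum_(i < m) p`_i * \tr (A ^+ i).
Proof.
move=> sp; rewrite -{1}[p]coefK poly_def !linear_sum /=.
rewrite (big_ord_widen m (fun i => \tr (horner_mx A (p`_i *: 'X^i)))) // big_mkcond /=.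
apply: eq_bigr => i _; case: ltnP => [_|ip]; last by rewrite nth_default ?mul0r.
by rewrite !linearZ /= rmorphXn /= horner_mx_X.
Qed.

Lemma char_poly_conj n (P A : 'M[K]_n) : P \in unitmx ->
  char_poly (invmx P *m A *m P) = char_poly A.
Proof.
move=> Pu; have PP : map_mx polyC (invmx P) *m map_mx polyC P = 1%:M.
  by rewrite -map_mxM mulVmx // map_mx1.
rewrite /char_poly /char_poly_mx !map_mxM.
have -> : 'X%:M - map_mx polyC (invmx P) *m map_mx polyC A *m map_mx polyC P =
  map_mx polyC (invmx P) *m ('X%:M - map_mx polyC A) *m map_mx polyC P.
  rewrite mulmxBr mulmxBl; congr (_ - _).
  by rewrite scalar_mxC -mulmxA PP mulmx1.
rewrite !det_mulmx mulrAC -det_mulmx PP det1 mul1r //.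
Qed.

Section Diagonalizable.
Variables (n : nat) (A : 'M[K]_n.+1) (rs : seq K).
Hypotheses (uniq_rs : uniq rs)
  (A_rs : horner_mx A (\prod_(r <- rs) ('X - r%:P)) = 0).

(** Eigenvalues are roots of the minimal polynomial, which divides the product over [rs]. *)
Lemma mup_char_poly_notin a : a \notin rs -> mup a (char_poly A) = 0%N.
Proof.
move=> ars; apply: mupNroot; rewrite -root_mxminpoly.
apply: contra ars => ra; rewrite -root_prod_XsubC.
rewrite root_factor_theorem in ra; rewrite root_factor_theorem.
exact: (dvdp_trans ra (mxminpoly_min A_rs)).
Qed.

(* [L / L.[a]] is the Lagrange idempotent at [a], so its value at [A] is a
   projection whose trace is the multiplicity of [a]. *)
Lemma mup_char_poly_trace a : a \in rs ->
  let L := \prod_(r <- rem a rs) ('X - r%:P) in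
  (mup a (char_poly A))%:R * L.[a] = \tr (horner_mx A L).
Proof.
move=> ars L.
have /diagonalizableP [P Pu /diagonalizable_forPex [d /(simmxLR Pu) defA]] :
    exists2 rs, uniq rs & mxminpoly A %| \prod_(x <- rs) ('X - x%:P).
  by exists rs => //; apply: mxminpoly_min.
rewrite mxpoly.conjVmx // in defA.
have hA p : horner_mx A p = invmx P *m diag_mx (map_mx (horner p) d) *m P.
  by rewrite -horner_mx_diag defA horner_mx_uconjC.
have trA p : \tr (horner_mx A p) = \sum_i p.[d 0 i].
  rewrite hA mxtrace_mulC mulmxA mulmxV // mul1mx mxtrace_diag.
  by apply: eq_bigr => i _; rewrite mxE.
have d_rs i : d 0 i \in rs.
  have : diag_mx (map_mx (horner (\prod_(r <- rs) ('X - r%:P))) d) = 0.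
    move: A_rs; rewrite hA => /(congr1 (fun B => P *m B *m invmx P)).
    by rewrite !mulmxA mulmxV // mul1mx mulmxK // mulmx0 mul0mx.
  move/matrixP/(_ i i); rewrite !mxE eqxx mulr1n => /eqP.
  by rewrite -[_ == 0]/(root _ _) root_prod_XsubC.
rewrite trA defA char_poly_conj // char_poly_trig ?diag_mx_is_trig //.
under eq_bigr do rewrite mxE eqxx mulr1n.
rewrite mup_prod_XsubC -sum1_count natr_sum mulr_suml big_mkcond /=.
rewrite -[index_enum _]/(index_enum 'I_n.+1) /=.
apply: eq_bigr => i _; case: eqVneq => [->|da]; first by rewrite mul1r.
symmetry; apply/eqP; rewrite -[_ == 0]/(root _ _) root_prod_XsubC.
by rewrite mem_rem_uniq // inE da d_rs.
Qed.
End Diagonalizable.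

(** The Lagrange polynomial at [a] has degree below [size rs], so the traces of these powers already
    fix the multiplicity of [a]. *)
Lemma mup_char_poly_eq m n (A : 'M[K]_m.+1) (B : 'M[K]_n.+1) (rs : seq K) a :
    uniq rs ->
    horner_mx A (\prod_(r <- rs) ('X - r%:P)) = 0 ->
    horner_mx B (\prod_(r <- rs) ('X - r%:P)) = 0 ->
    (forall i, (i < size rs)%N -> \tr (A ^+ i) = \tr (B ^+ i)) ->
  mup a (char_poly A) = mup a (char_poly B).
Proof.
move=> urs A0 B0 trAB; have [ars|ars] := boolP (a \in rs); last first.
  by rewrite !(@mup_char_poly_notin _ _ rs).
set L := \prod_(r <- rem a rs) ('X - r%:P).
have sL : (size L <= size rs)%N.
  by rewrite size_prod_XsubC size_rem // prednK // -has_predT; apply/hasP; exists a.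
have La : L.[a] != 0.
  by rewrite -[_ == 0]/(root _ _) root_prod_XsubC mem_rem_uniq // inE eqxx.
apply/eqP; rewrite -(eqr_nat K) -(inj_eq (mulIf La)).
rewrite !mup_char_poly_trace // !(@tr_horner_mx _ _ L _ sL).
by apply/eqP; apply: eq_bigr => i _; rewrite trAB.
Qed.


(** * The spectrum forced by the quadratic relation *)

Section NetSpectrum.
Variables (s q N : nat).

(** [M] stands for the adjacency matrix plus the identity, so the scalar in the third relation is
    the degree plus one. *)
Definition net_like v (M F : 'M[K]_v) : Prop :=
  [/\ M *m M = (s * (q * q.+1))%:R *: const_mx 1 + (s%:R * (N%:R - 2 * q%:R)) *: M
        + (s%:R * (N%:R - q%:R)) *: F,
      M *m F = (s * q)%:R *: M,
      M *m const_mx 1 = (s%:R * ((q * N)%:R + N%:R - q%:R)) *: (const_mx 1 : 'M_v),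
      \tr M = v%:R & \tr F = q%:R * v%:R].

Let c1 : K := (s * (q * q.+1))%:R.
Let kap : K := s%:R * ((q * N)%:R + N%:R - q%:R).
Let a : K := s%:R * (N%:R - q%:R).
Let b : K := (s * q)%:R.
Let rs : seq K := [:: kap - 1; -1; a - 1; - b - 1].

(** Multiplying the quadratic relation by [M] on the left turns [F] into a multiple of [M], so [F]
    drops out. *)
Lemma net_like_cube v (M F : 'M[K]_v) : net_like M F ->
  M *m (M *m M) = (c1 * kap) *: const_mx 1 + (a - b) *: (M *m M) + (a * b) *: M.
Proof.
have abE : s%:R * (N%:R - 2 * q%:R) = a - b by rewrite /a /b natrM; ring.
case=> [MM MF MJ trM trF]; rewrite {1}MM !mulmxDr -!scalemxAr MF MJ !scalerA.
by rewrite abE -/a -/b -/kap -/c1.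
Qed.

(** By the cubic relation [M (M - a) (M + b)] is a multiple of the all-one matrix, which [M - kap]
    kills. The roots in [rs] are shifted by -1 because the matrix is [M - 1]. *)
Lemma net_like_annihilated v (M F : 'M[K]_v.+1) : net_like M F ->
  horner_mx (M - 1%:M) (\prod_(r <- rs) ('X - r%:P)) = 0.
Proof.
move=> nM; have M3 := net_like_cube nM; case: nM => [MM MF MJ _ _].
rewrite !big_cons big_nil mulr1 !rmorphM !rmorphB /= !horner_mx_X !horner_mx_C.
have shift r : M - 1%:M - (r%:M - 1%:M) = M - r%:M by rewrite opprB addrA subrK.
have shift0 : M - 1%:M - (-1)%:M = M by rewrite raddfN /= opprK subrK.
rewrite !shift shift0.
have -> : (M - a%:M) * (M - (- b)%:M) = M *m M - (a - b) *: M - (a * b)%:M.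
  rewrite -[_ * _]/(_ *m _) mulmxBl !mulmxBr !mul_scalar_mx mul_mx_scalar.
  move: (M *m M) => X; apply/matrixP => i j; rewrite !mxE.
  by case: (i == j); rewrite ?mulr1n ?mulr0n; ring.
rewrite -[M * _]/(M *m _) !mulmxBr mul_mx_scalar -scalemxAr M3 addrAC addrK addrK.
rewrite -[_ * _]/(_ *m _) mulmxBl -scalemxAr MJ mul_scalar_mx.
by rewrite !scalerA [c1 * kap * _]mulrC subrr.
Qed.

(** The quadratic relation yields the trace of [M^2] from those of [J], [M] and [F], and the cubic
    one that of [M^3]. *)
Lemma net_like_trace v (M F : 'M[K]_v.+1) i : net_like M F -> (i < 4)%N ->
  \tr ((M - 1%:M) ^+ i) =
    [:: 1; 0; kap - 1; c1 * kap + (a - b) * kap + a * b - 3 * kap + 2]`_i * v.+1%:R.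
Proof.
move=> nM; have M3 := net_like_cube nM; case: nM => [MM MF MJ trM trF].
have trJ : \tr (const_mx 1 : 'M[K]_v.+1) = v.+1%:R.
  by rewrite /mxtrace; under eq_bigr do rewrite mxE; rewrite sumr_const card_ord.
have tr2 : \tr (M *m M) = kap * v.+1%:R.
  rewrite MM !linearD !linearZ /= trJ trM trF /kap !natrM -[q.+1]addn1 natrD.
  by ring.
have tr3 : \tr (M *m (M *m M)) = (c1 * kap + (a - b) * kap + a * b) * v.+1%:R.
  by rewrite M3 !linearD !linearZ /= trJ trM tr2; ring.
have sq1 : (M - 1%:M) *m (M - 1%:M) = M *m M - M - M + 1%:M.
  by rewrite mulmxBl !mulmxBr !mulmx1 mul1mx opprB addrA addrAC.
case: i => [|[|[|[|i]]]] //= _.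
- by rewrite expr0 mxtrace1 mul1r.
- by rewrite expr1 linearB /= mxtrace1 trM subrr mul0r.
- by rewrite expr2 -[_ * _]/(_ *m _) sq1 !raddfD !raddfN /= mxtrace1 trM tr2; ring.
rewrite exprS expr2 -[_ * _]/(_ *m (_ *m _)) sq1 mulmxBl mul1mx.
rewrite !(mulmxDr, mulmxBr) mulmx1 !(raddfD, raddfN) /= mxtrace1 trM tr2 tr3.
by rewrite opprK; ring.
Qed.

Lemma net_like_mup v w (A F : 'M[K]_v) (B H : 'M[K]_w) x :
    (0 < s)%N -> (0 < q)%N -> (q < N)%N -> v = w ->
    net_like (A + 1%:M) F -> net_like (B + 1%:M) H ->
  mup x (char_poly A) = mup x (char_poly B).
Proof.
(* The two orders are vertex counts that are only provably equal, hence the transport along [vw].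
   Order 0 is split off because polynomial evaluation is used at sizes of the form [v.+1]. *)
move=> s0 q0 qN vw; case: _ / vw B H => {w} B H nA nB.
case: v A B F H nA nB => [|v] A B F H nA nB; first by rewrite (thinmx0 A) (thinmx0 B).
rewrite -[A](addrK 1%:M) -[B](addrK 1%:M).
have [sK qK] : 0 < s%:R :> K /\ 0 < q%:R :> K by rewrite !ltr0n.
have NK : q%:R < N%:R :> K by rewrite ltr_nat.
have a0 : 0 < a by rewrite mulr_gt0 // subr_gt0.
have b0 : 0 < b by rewrite ltr0n muln_gt0 s0.
have ka : a < kap.
  by rewrite /a /kap ltr_pM2l // -addrA ltrDr natrM mulr_gt0 // (lt_trans qK).
apply: (@mup_char_poly_eq _ _ _ _ rs).
(* Before the shift the roots satisfy [- b < 0 < a < kap]; [0 < a] comes from [q < N]. *)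
- have uE : uniq [:: kap; 0; a; - b].
    have b_lt0 : - b < 0 by rewrite oppr_lt0.
    rewrite /= !inE !negb_or !andbT (gt_eqF (lt_trans a0 ka)) (gt_eqF ka).
    rewrite (lt_eqF a0) (gt_eqF b_lt0) (gt_eqF (lt_trans b_lt0 a0)).
    by rewrite (gt_eqF (lt_trans b_lt0 (lt_trans a0 ka))).
  have -> : rs = map (fun y => y - 1) [:: kap; 0; a; - b] by rewrite /= sub0r.
  by rewrite map_inj_uniq //; apply: addIr.
- exact: net_like_annihilated nA.
- exact: net_like_annihilated nB.
- by move=> i i4; rewrite (net_like_trace nA) // (net_like_trace nB).
Qed.

End NetSpectrum.

End Spectrum.

(** * Orthogonal arrays *)

Section Kernel.
Local Open Scope ring_scope.
Variables (K : pzRingType) (X : finType).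
Implicit Types f g : X -> X -> K.

Definition kernel_mx f : 'M[K]_#|X| := \matrix_(i, j) f (enum_val i) (enum_val j).

Lemma eq_kernel_mx f g : f =2 g -> kernel_mx f = kernel_mx g.
Proof. by move=> fg; apply/matrixP => i j; rewrite !mxE fg. Qed.

Lemma mul_kernel_mx f g :
  kernel_mx f *m kernel_mx g = kernel_mx (fun x y => \sum_z f x z * g z y).
Proof.
apply/matrixP => i j; rewrite !mxE [RHS](reindex_onto enum_val enum_rank) /=.
  by apply: eq_big => [k|k _]; rewrite ?enum_valK ?eqxx // !mxE.
by move=> x _; rewrite enum_rankK.
Qed.

Lemma tr_kernel_mx f : \tr (kernel_mx f) = \sum_x f x x.
Proof.
rewrite [RHS](reindex_onto enum_val enum_rank) /=; last by move=> x _; rewrite enum_rankK.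
by apply: eq_big => [k|k _]; rewrite ?enum_valK ?eqxx // !mxE.
Qed.

End Kernel.

(** Rows are indexed by [I], columns by [X], symbols by [Y]; the strength is 2, and index 1 gives
    the usual [OA(N,m)]. *)
Definition oa_index (I X Y : finType) (g : I -> X -> Y) (s : nat) : Prop :=
  forall i j a b, i != j -> #|[set x | (g i x == a) && (g j x == b)]| = s.

Section OrthogonalArray.
Variables (I X Y : finType) (g : I -> X -> Y) (s : nat).
Hypotheses (gP : oa_index g s) (I_gt1 : 1 < #|I|).

Lemma card_fibres (P : pred X) (f : X -> Y) :
  #|[set x | P x]| = \sum_y #|[set x | P x && (f x == y)]|.
Proof.
rewrite -sum1dep_card (partition_big f xpredT) //=.
by apply: eq_bigr => y _; rewrite -sum1dep_card.
Qed.

Lemma other_row i : exists j : I, i != j.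
Proof.
have : 0 < #|[set~ i]| by rewrite cardsC1 -subn1 subn_gt0.
by case/card_gt0P => j; rewrite !inE => ji; exists j; rewrite eq_sym.
Qed.

Lemma oa_card1 i a : #|[set x | g i x == a]| = #|Y| * s.
Proof.
have [j ij] := other_row i; rewrite (card_fibres _ (g j)).
by under eq_bigr do rewrite gP //; rewrite sum_nat_const.
Qed.

Lemma oa_card : #|X| = #|Y| * (#|Y| * s).
Proof.
have /card_gt0P [i _] : 0 < #|I| by apply: ltnW.
rewrite -[RHS]sum_nat_const.
have -> : #|X| = #|[set x : X | xpredT x]|.
  by rewrite -cardsT; apply: eq_card => x; rewrite !inE.
by rewrite (card_fibres _ (g i)); apply: eq_bigr => a _; rewrite oa_card1.
Qed.

Section Kernels.
Local Open Scope ring_scope.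
Variable K : numFieldType.
Definition agree i x y : K := (g i x == g i y)%:R.

Lemma agreeC i x y : agree i x y = agree i y x.
Proof. by rewrite /agree eq_sym. Qed.

Lemma sum_indicator (P : pred X) : \sum_x (P x)%:R = #|[set x | P x]|%:R :> K.
Proof. by rewrite -natr_sum -big_mkcond sum1dep_card. Qed.

Lemma sum_agree i x : \sum_z agree i x z = (#|Y| * s)%:R.
Proof.
by rewrite sum_indicator -(oa_card1 i (g i x)); under eq_finset do rewrite eq_sym.
Qed.

(** For [i = j], [z] runs over the common class of [x] and [y] in row [i], if there is one; for
    [i != j], [z] has prescribed entries in two distinct rows. *)
Lemma agree_agree i j x y :
  \sum_z agree i x z * agree j z y =
    if i == j then (#|Y| * s)%:R * agree i x y else s%:R.
Proof.
under eq_bigr do rewrite -natrM mulnb.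
rewrite sum_indicator; case: eqVneq => [<-|ij]; last first.
  by rewrite -(gP (g i x) (g j y) ij); under eq_finset do rewrite [g i x == _]eq_sym.
rewrite /agree; case: eqVneq => xy.
  rewrite mulr1 -(oa_card1 i (g i y)); congr (_%:R).
  by apply: eq_card => z; rewrite !inE xy [g i y == _]eq_sym andbb.
rewrite mulr0 (_ : [set z | _] = set0) ?cards0 //.
apply/setP => z; rewrite !inE; apply/negP => /andP [/eqP xz /eqP zy].
by rewrite xz zy eqxx in xy.
Qed.

Variables (q : nat) (F : X -> X -> K).
Hypotheses (cardI : #|I| = q.+1) (s_gt0 : (0 < s)%N).
Hypotheses
  (agreeF : forall i x y, \sum_z agree i x z * F z y = (s * q)%:R * agree i x y)
  (Fsym : forall x y, F x y = F y x)
  (FF : forall x y, \sum_z F x z * F z y = (s * q)%:R * F x y)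
  (Fdiag : forall x, F x x = q%:R).

(** With [C] the sum of the [R i], the [q(q+1)] ordered pairs of distinct rows each contribute [s J]
    to [C^2], and the squares add up to [N s C]. Since [C F = F C = s q C], expanding [(C - F)^2]
    and substituting [C = M + F] gives the quadratic relation. *)
Lemma oa_net_like :
  net_like s q #|Y|
    (kernel_mx (fun x y => \sum_i agree i x y - F x y)) (kernel_mx F).
Proof.
set N := #|Y|; pose R i := kernel_mx (agree i); pose C := \sum_i R i.
pose Fm := kernel_mx F; pose J := const_mx 1 : 'M[K]_#|X|.
have -> : kernel_mx (fun x y => \sum_i agree i x y - F x y) = C - Fm.
  apply/matrixP => x y; rewrite !mxE summxE; congr (_ - _).
  by apply: eq_bigr => i _; rewrite mxE.
have mkZ c f : kernel_mx (fun x y => c * f x y) = c *: kernel_mx f :> 'M[K]_#|X|.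
  by apply/matrixP => x y; rewrite !mxE.
have RR i j : R i *m R j = if i == j then (N * s)%:R *: R i else s%:R *: J.
  rewrite mul_kernel_mx (eq_kernel_mx (agree_agree i j)); case: eqP => _.
    by rewrite mkZ.
  by apply/matrixP => x y; rewrite !mxE mulr1.
have RF i : R i *m Fm = (s * q)%:R *: R i.
  by rewrite mul_kernel_mx (eq_kernel_mx (agreeF i)) mkZ.
have FR i : Fm *m R i = (s * q)%:R *: R i.
  rewrite -mkZ mul_kernel_mx; apply: eq_kernel_mx => x y; rewrite agreeC -agreeF.
  by apply: eq_bigr => z _; rewrite Fsym agreeC mulrC.
have F2 : Fm *m Fm = (s * q)%:R *: Fm by rewrite mul_kernel_mx (eq_kernel_mx FF) mkZ.
have CF : C *m Fm = (s * q)%:R *: C.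
  by rewrite mulmx_suml scaler_sumr; apply: eq_bigr.
have FC : Fm *m C = (s * q)%:R *: C.
  by rewrite mulmx_sumr scaler_sumr; apply: eq_bigr.
have CC : C *m C = (N * s)%:R *: C + (s * (q * q.+1))%:R *: J.
  rewrite mulmx_suml; under eq_bigr => i _.
    rewrite mulmx_sumr (bigD1 i) //= RR eqxx.
    under eq_bigr => j ji do rewrite RR eq_sym (negPf ji).
    rewrite sumr_const cardC1 cardI /=; over.
  rewrite big_split /= -scaler_sumr sumr_const cardI -!scaler_nat !scalerA.
  by congr (_ + _ *: _); rewrite -!natrM; congr (_%:R); lia.
have JE : J = kernel_mx (fun _ _ => 1) by apply/matrixP => x y; rewrite !mxE.
have RJ i : R i *m J = (N * s)%:R *: J.
  rewrite JE mul_kernel_mx -mkZ; apply: eq_kernel_mx => x y.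
  by under eq_bigr do rewrite mulr1; rewrite sum_agree mulr1.
have CJ : C *m J = (q.+1 * (N * s))%:R *: J.
  rewrite mulmx_suml; under eq_bigr do rewrite RJ.
  by rewrite sumr_const cardI -scaler_nat scalerA -natrM.
(* The row sums of [F] follow from [s J = R i R j] and [F R i = s q R i] after cancelling [s]. *)
have FJ : Fm *m J = (s * q)%:R *: J.
  have /card_gt0P [i _] : (0 < #|I|)%N by apply: ltnW.
  have [j ij] := other_row i.
  have s0 : s%:R != 0 :> K by rewrite pnatr_eq0 -lt0n.
  apply: (scalerI s0); rewrite scalemxAr scalerA mulrC -scalerA.
  have <- : R i *m R j = s%:R *: J by rewrite RR (negPf ij).
  by rewrite mulmxA FR scalemxAl.
split.
- rewrite mulmxBl !mulmxBr CC CF FC F2 !natrM -[q.+1]addn1 natrD.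
  apply/matrixP => x y; rewrite !mxE; ring.
- by rewrite mulmxBl CF F2 scalerBr.
- rewrite mulmxBl CJ FJ -scalerBl; congr (_ *: _).
  by rewrite -[q.+1]addn1 !natrM natrD; ring.
- rewrite raddfB /= raddf_sum /=.
  under eq_bigr do rewrite tr_kernel_mx; rewrite tr_kernel_mx.
  under eq_bigr do under eq_bigr do rewrite /agree eqxx.
  under [X in _ - X]eq_bigr do rewrite Fdiag.
  rewrite !sumr_const cardI -(mulr_natr (_ *+ _)) -(mulr_natr q%:R) -[q.+1]addn1 natrD.
  by rewrite -[#|xpredT|]/#|X| /=; ring.
- rewrite tr_kernel_mx; under eq_bigr do rewrite Fdiag.
  by rewrite sumr_const mulr_natr.
Qed.

End Kernels.
End OrthogonalArray.

Lemma card_fibre_inj (X Z : finType) (h : X -> Z) z :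
  injective h -> #|Z| <= #|X| -> #|[set x | h x == z]| = 1.
Proof.
move=> hI ZX; have [h' hK h'K] := inj_card_bij hI ZX.
by rewrite (_ : [set x | _] = [set h' z]) ?cards1 //; apply/setP => x;
  rewrite !inE; apply/eqP/eqP => [<-|->].
Qed.

Lemma oa_index1_inj (I X Y : finType) (g : I -> X -> Y) :
    (forall i j, i != j -> injective (fun x => (g i x, g j x))) ->
    #|X| = #|Y| ^ 2 ->
  oa_index g 1.
Proof.
move=> gI cX i j a b ij.
by rewrite -(card_fibre_inj (a, b) (gI i j ij)) // card_prod cX.
Qed.

Lemma oa_index_prod (I X X' Y Y' : finType) (g : I -> X -> Y) (g' : I -> X' -> Y') s s' :
  oa_index g s -> oa_index g' s' ->
  oa_index (fun i (x : X * X') => (g i x.1, g' i x.2)) (s * s').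
Proof.
move=> gP g'P i j [a a'] [b b'] ij.
rewrite -(gP i j a b ij) -(g'P i j a' b' ij) -cardsX; apply: eq_card => -[x x'].
by rewrite !inE !xpair_eqE /= andbACA.
Qed.

Lemma oa_index_copies (I X Y Z : finType) (g : I -> X -> Y) s :
  oa_index g s -> oa_index (fun i (x : X * Z) => g i x.1) (s * #|Z|).
Proof.
move=> gP i j a b ij; rewrite -(gP i j a b ij) -[#|Z|]cardsT -cardsX.
by apply: eq_card => x; rewrite !inE andbT.
Qed.

(** * Graphs *)

Section Graphs.
Local Open Scope ring_scope.

Definition closed_adj (G : sgraph) (x y : G) : algC := ((x == y) || adj x y)%:R.

Lemma adj_mx_closed (G : sgraph) : adj_mx G + 1%:M = kernel_mx (@closed_adj G).
Proof.
apply/matrixP => i j; rewrite !mxE /closed_adj (inj_eq enum_val_inj).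
by case: eqVneq => [->|_]; rewrite ?adj_irr ?add0r ?addr0.
Qed.

Section OneGraph.
Variables (q s N : nat) (G : sgraph) (F : G -> G -> algC).
Hypothesis netG : net_like s q N (adj_mx G + 1%:M) (kernel_mx F).

Lemma net_like_regular : regular G.
Proof.
case: netG => _ _ MJ _ _; rewrite adj_mx_closed in MJ.
have JE : const_mx 1 = kernel_mx (fun _ _ => 1) :> 'M[algC]_#|G|.
  by apply/matrixP => i j; rewrite !mxE.
have deg (x : G) : #|[set z | adj x z]|.+1%:R =
    s%:R * ((q * N)%:R + N%:R - q%:R) :> algC.
  move: MJ; rewrite JE mul_kernel_mx => /matrixP/(_ (enum_rank x) (enum_rank x)).
  rewrite !mxE !enum_rankK mulr1 => <-; under [RHS]eq_bigr do rewrite mulr1.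
  rewrite sum_indicator -[RHS]/(_%:R); congr (_%:R).
  have -> : [set z | (x == z) || adj x z] = x |: [set z | adj x z].
    by apply/setP => z; rewrite !inE [x == z]eq_sym.
  by rewrite cardsU1 inE adj_irr.
case: (pickP (@predT G)) => [x0 _|G0]; last first.
  by exists 0%N => x; have := G0 x.
exists #|[set z | adj x0 z]| => x.
by apply: succn_inj; apply/eqP; rewrite -(eqr_nat algC) !deg.
Qed.

(** The [(x, y)] entry of [(A + I)^2] counts the common neighbours and, when [x] and [y] are
    adjacent, also [x] and [y] themselves. *)
Lemma net_like_common_nbrs (x y : G) : x != y ->
  (#|common_nbrs x y| + 2 * adj x y)%:R =
    (s * (q * q.+1))%:R + (s%:R * (N%:R - 2 * q%:R)) * (adj x y)%:R
      + (s%:R * (N%:R - q%:R)) * F x y :> algC.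
Proof.
move=> xy; case: netG => MM _ _ _ _; move: MM; rewrite adj_mx_closed mul_kernel_mx.
move=> /matrixP/(_ (enum_rank x) (enum_rank y)).
rewrite !mxE !enum_rankK mulr1.
have -> : closed_adj x y = (adj x y)%:R by rewrite /closed_adj (negPf xy).
move=> <-; rewrite /closed_adj.
under eq_bigr do rewrite -natrM mulnb.
rewrite sum_indicator; congr (_%:R).
have -> : [set z | ((x == z) || adj x z) && ((z == y) || adj z y)] =
    common_nbrs x y :|: [set z in [:: x; y] | adj x y].
  apply/setP => z; rewrite !inE [adj z y]adj_sym [x == z]eq_sym.
  case: eqVneq => [->|zx] /=; last first.
    case: eqVneq => [->|zy] /=; last by rewrite orbF.
    by rewrite andbT adj_irr andbF.
  by rewrite (negPf xy) /= adj_sym adj_irr.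
rewrite cardsU (_ : _ :&: _ = set0) ?cards0 ?subn0; last first.
  apply/setP => z; rewrite !inE; apply/negP => /andP [/andP [xz yz]] /andP [].
  by case/orP => /eqP zE; rewrite zE adj_irr in xz yz.
congr (_ + _)%N; case: (adj x y) => /=.
  by rewrite (_ : [set z | _] = [set x; y]) ?cards2 ?xy //; apply/setP => z; rewrite !inE andbT.
rewrite (_ : [set z | _] = set0) ?cards0 //.
by apply/setP => z; rewrite !inE andbF.
Qed.

End OneGraph.

Section Agreement.
Variables (I X Y : finType) (g : I -> X -> Y).
Hypothesis gP : oa_index g 1.

Lemma index1_eq i j x y : i != j -> g i x = g i y -> g j x = g j y -> x = y.
Proof.
move=> ij gi gj; have /eqP/cards1P [z zE] := gP (g i x) (g j x) ij.
have : x \in [set z] by rewrite -zE inE !eqxx.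
have : y \in [set z] by rewrite -zE inE gi gj !eqxx.
by rewrite !inE => /eqP -> /eqP.
Qed.

(** Distinct columns of an array of index 1 agree in at most one row, so the sum has at most one
    nonzero term. *)
Lemma sum_agree_index1 x y : x != y ->
  \sum_i agree g algC i x y = [exists i, g i x == g i y]%:R.
Proof.
move=> xy; case: existsP => [[i /eqP gi]|nex]; last first.
  by apply: big1 => i _; rewrite /agree; case: eqP => // gi; case: nex; exists i; apply/eqP.
rewrite (bigD1 i) //= {1}/agree gi eqxx big1 ?addr0 // => j ji.
rewrite /agree; case: eqP => // gj; case/eqP: xy.
by apply: (@index1_eq i j) => //; rewrite eq_sym.
Qed.

End Agreement.

Lemma sum_diag (Z : finType) (z : Z) (f : Z -> algC) :
  \sum_y f y * (y == z)%:R = f z.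
Proof.
rewrite (bigD1 z) //= eqxx mulr1 big1 ?addr0 // => y yz.
by rewrite (negPf yz) mulr0.
Qed.

(** * Clique extensions of Latin square graphs *)

Section CliqueExtension.
Variables (N q s : nat) (A : 'M['I_N]_(q + 1, N ^ 2)).
Hypotheses (AP : orthogonal_array A) (q_gt0 : (0 < q)%N) (s_gt0 : (0 < s)%N).
Let G := clique_extension s (latin_square_graph A).

Definition same_copy (x y : G) : algC := (x.1 == y.1)%:R.

(** Repeating each column [s] times gives index [s]. Vertices in the same clique agree in all [q+1]
    rows, and subtracting [q] leaves the entry 1; otherwise the columns are distinct and agree at
    most once. *)
Lemma clique_extension_net_like :
  net_like s q N (adj_mx G + 1%:M) (kernel_mx (fun x y => q%:R * same_copy x y)).
Proof.
have A1 : oa_index A 1 by apply: oa_index1_inj => //; rewrite !card_ord.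
have As : oa_index (fun i (x : G) => A i x.1) s.
  by have := @oa_index_copies _ _ _ 'I_s _ _ A1; rewrite mul1n card_ord.
have I1 : (1 < #|'I_(q + 1)|)%N by rewrite card_ord addn1.
have cI : #|'I_(q + 1)| = q.+1 by rewrite card_ord addn1.
have sum_copy (f : 'I_(N ^ 2) -> algC) (y : G) :
    \sum_(z : G) f z.1 * same_copy z y = s%:R * f y.1.
  rewrite -(pair_bigA _ (fun c (k : 'I_s) => f c * (c == y.1)%:R)) /=.
  under eq_bigr do rewrite sumr_const card_ord -[_ *+ s]mulr_natl.
  by rewrite -mulr_sumr sum_diag.
rewrite adj_mx_closed -[N in net_like _ _ N]card_ord.
rewrite (eq_kernel_mx (g := fun x y => \sum_i agree (fun i (x : G) => A i x.1) algC i x y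
   - q%:R * same_copy x y)); last first.
  move=> [c k] [d l]; rewrite /closed_adj /same_copy /= /ext_adj /= orb_andr orbN /=.
  rewrite xpair_eqE; case: (eqVneq c d) => [->|cd] /=.
    rewrite orbT; under eq_bigr do rewrite /agree eqxx.
    by rewrite sumr_const cI mulr1 -[q.+1]addn1 natrD addrC addKr.
  rewrite mulr0 subr0 /ls_adj /= cd; exact/esym/(sum_agree_index1 A1 cd).
apply: oa_net_like => //.
- move=> i x y; under eq_bigr do rewrite mulrCA.
  by rewrite -mulr_sumr (sum_copy (fun c => (A i x.1 == A i c)%:R)) natrM mulrCA mulrA.
- by move=> x y; rewrite /same_copy eq_sym.
- move=> x y; under eq_bigr do rewrite mulrCA.
  rewrite -mulr_sumr (sum_copy (fun c => q%:R * (x.1 == c)%:R)) natrM /same_copy.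
  by ring.
- by move=> x; rewrite /same_copy eqxx mulr1.
Qed.

End CliqueExtension.
End Graphs.

(** * The twisted product of two arrays *)

Section Twist.
Local Open Scope ring_scope.
Variables (q s n : nat) (I U W Y Z : finType) (f : I -> U -> Y) (h : I -> W -> Z).
Hypotheses (fP : oa_index f s) (hP : oa_index h 1).
Hypotheses (cI : #|I| = q.+1) (cY : #|Y| = q) (cZ : #|Z| = n).
Hypotheses (q_gt0 : (0 < q)%N) (s_gt0 : (0 < s)%N) (n_gt1 : (1 < n)%N).

Let I_gt1 : (1 < #|I|)%N. Proof. by rewrite cI. Qed.

Definition twist_adj : rel (U * W) :=
  [rel x y | (x != y) &&
    ((x.2 == y.2) || [exists i, (f i x.1 == f i y.1) && (h i x.2 == h i y.2)])].

Lemma twist_adj_sym : symmetric twist_adj.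
Proof.
move=> x y; rewrite /twist_adj /= eq_sym [x.2 == _]eq_sym; congr (_ && (_ || _)).
by apply: eq_existsb => i; rewrite eq_sym [h i _ == _]eq_sym.
Qed.

Lemma twist_adj_irr : irreflexive twist_adj.
Proof. by move=> x; rewrite /twist_adj /= eqxx. Qed.

Definition twist := SGraph twist_adj_sym twist_adj_irr.

Notation t := (agree f algC).

Let D u v : algC := \sum_i t i u v - 1.

Definition twist_corr (x y : twist) : algC := D x.1 y.1 * (x.2 == y.2)%:R.

Let DC u v : D u v = D v u.
Proof. by congr (_ - _); apply: eq_bigr => i _; rewrite agreeC. Qed.

(** The rows [j != i] contribute [q s] in total and the term [-1] of [D] contributes [- q s]; they
    cancel because [f] has [q] symbols and [q+1] rows. *)
Let tD i u v : \sum_w t i u w * D w v = (s * q)%:R * t i u v.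
Proof.
rewrite /D; under eq_bigr do rewrite mulrBr mulr1 mulr_sumr.
rewrite sumrB exchange_big /= (sum_agree fP) // (bigD1 i) //= (agree_agree fP) // eqxx.
under eq_bigr => j ji do rewrite (agree_agree fP) // eq_sym (negPf ji).
rewrite sumr_const cardC1 cI cY /= -[_ *+ q]mulr_natl !natrM; ring.
Qed.

Let DD u v : \sum_w D u w * D w v = (s * q)%:R * D u v.
Proof.
have sumD : \sum_w D w v = (s * q)%:R.
  rewrite /D sumrB exchange_big /=.
  under eq_bigr do (under eq_bigr do rewrite agreeC); under eq_bigr do rewrite (sum_agree fP) //.
  rewrite !sumr_const cI cY (_ : #|_| = #|U|) // (oa_card fP) // cY.
  by rewrite -(mulr_natr (_%:R)) !natrM -[q.+1]addn1 natrD; ring.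
rewrite {1}/D; under eq_bigr do rewrite mulrBl mul1r mulr_suml.
rewrite sumrB exchange_big sumD /=; under eq_bigr do rewrite tD.
by rewrite -mulr_sumr /D mulrBr mulr1.
Qed.

Let g i (x : U * W) := (f i x.1, h i x.2).

(** Over equal [W]-components all rows of [h] agree, and the correction removes all but 1 from the
    sum; over different ones [h] agrees in at most one row. *)
Lemma twist_closed (x y : twist) :
  closed_adj x y = \sum_i agree g algC i x y - twist_corr x y.
Proof.
case: x y => [u a] [v b]; rewrite /closed_adj /twist_corr /= /twist_adj /= orb_andr orbN /=.
rewrite xpair_eqE; case: (eqVneq a b) => [->|ab] /=.
  rewrite orbT mulr1 /D; apply/esym/eqP; rewrite subr_eq addrC subrK; apply/eqP.
  by apply: eq_bigr => i _; rewrite /agree xpair_eqE eqxx andbT.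
rewrite andbF mulr0 subr0 /=; case: existsP => [[i /andP [fi hi]]|nex]; last first.
  apply/esym/big1 => i _; rewrite /agree xpair_eqE; case: andP => // fh.
  by case: nex; exists i; apply/andP.
rewrite (bigD1 i) //= {1}/agree xpair_eqE fi hi big1 ?addr0 // => j ji.
rewrite /agree xpair_eqE; case: (h j a =P h j b) => hj; last by rewrite andbF.
by case/eqP: ab; apply: (index1_eq hP ji hj (eqP hi)).
Qed.

(** The array [g] has index [s * 1] and [q n] symbols. The correction is [D] tensored with the
    identity on [W], so its identities reduce to [tD] and [DD]. *)
Lemma twist_net_like :
  net_like s q (q * n) (adj_mx twist + 1%:M) (kernel_mx twist_corr).
Proof.
have gP : oa_index g s by rewrite -[s]muln1; apply: oa_index_prod.
have sum_corr (k : U -> W -> algC) (y : twist) :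
    \sum_(z : twist) k z.1 z.2 * twist_corr z y = \sum_w k w y.2 * D w y.1.
  rewrite -(pair_bigA _ (fun w c => k w c * (D w y.1 * (c == y.2)%:R))) /=.
  apply: eq_bigr => w _; rewrite -(sum_diag y.2 (fun c => k w c * D w y.1)).
  by apply: eq_bigr => c _; rewrite mulrA.
rewrite adj_mx_closed (eq_kernel_mx twist_closed).
rewrite (_ : (q * n)%N = #|{: Y * Z}|); last by rewrite card_prod cY cZ.
apply: oa_net_like => //.
- move=> i x y.
  rewrite (sum_corr (fun w c => agree g algC i x (w, c))).
  under eq_bigr do rewrite /agree xpair_eqE /= -mulnb natrM mulrAC.
  by rewrite -mulr_suml tD /agree xpair_eqE -mulnb -!natrM mulnA.
- by move=> x y; rewrite /twist_corr DC eq_sym.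
- move=> x y; rewrite (sum_corr (fun w c => D x.1 w * (x.2 == c)%:R)).
  under eq_bigr do rewrite mulrAC.
  by rewrite -mulr_suml DD /twist_corr mulrA.
- move=> x; rewrite /twist_corr /D eqxx mulr1.
  under eq_bigr do rewrite /agree eqxx.
  by rewrite sumr_const cI -[q.+1]addn1 natrD addrK.
Qed.

Definition num_agree u v := #|[set i | f i u == f i v]|.

(** The correction equals [num_agree - 1] over equal [W]-components and 0 otherwise, which is why
    the latter case looks like one agreement. Non-adjacent vertices always lie over different
    components. *)
Lemma twist_common_nbrs (x y : twist) : x != y ->
  (#|common_nbrs x y| + 2 * adj x y =
    if adj x y then
      s * q ^ 2 + s * (q * n - q) * (if x.2 == y.2 then num_agree x.1 y.1 else 1)
    else s * (q * q.+1))%N.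
Proof.
move=> xy; apply/eqP; rewrite -(eqr_nat algC) (net_like_common_nbrs twist_net_like xy).
have qn : (q <= q * n)%N by rewrite leq_pmulr // ltnW.
rewrite /twist_corr; case: ifP => [|/negbT]; rewrite /= /twist_adj /= xy /=; last first.
  by rewrite negb_or => /andP [/negPf-> _]; rewrite !mulr0 !addr0.
have -> : D x.1 y.1 = (num_agree x.1 y.1)%:R - 1.
  by rewrite /D /agree sum_indicator.
rewrite !natrD !natrM natrB // !natrM -[q.+1]addn1 natrD.
by case: eqP => _ /= _; apply/eqP; ring.
Qed.

Lemma twist_co_edge_regular : co_edge_regular twist.
Proof.
split; first exact: net_like_regular twist_net_like.
exists (s * (q * q.+1))%N => x y xy nxy; have := twist_common_nbrs xy.
by rewrite (negPf nxy) muln0 addn0.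
Qed.

Lemma twist_level (T : seq nat) :
    (0 < #|W|)%N -> (2 <= s * q ^ 2)%N -> uniq T -> 1%N \in T ->
    (forall u v, u != v -> num_agree u v \in T) ->
    (forall k, k \in T -> exists u v, u != v /\ num_agree u v = k) ->
  has_level twist (size T).
Proof.
move=> /card_gt0P [a _] sq2 uT T1 numT Tnum.
(* The truncated subtraction is exact by [2 <= s * q ^ 2]; injectivity comes from [1 < n]. *)
pose lam k := (s * q ^ 2 - 2 + s * (q * n - q) * k)%N.
have lamI : injective lam.
  move=> k l /eqP; rewrite /lam eqn_add2l eqn_pmul2l; first by move/eqP.
  by rewrite muln_gt0 s_gt0 subn_gt0 -{1}[q]muln1 ltn_pmul2l.
rewrite /has_level -(size_map lam); apply: perm_size; apply: uniq_perm.
- exact: undup_uniq.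
- by rewrite map_inj_uniq.
have lamE (x y : twist) : adj x y ->
    #|common_nbrs x y| = lam (if x.2 == y.2 then num_agree x.1 y.1 else 1%N).
  move=> axy; have xy : x != y by apply: contraTneq axy => ->; rewrite adj_irr.
  have := twist_common_nbrs xy; rewrite axy /lam; lia.
move=> k; rewrite mem_undup; apply/imageP/mapP => [[[x y]]|[l lT ->]].
  rewrite inE /= => axy ->; rewrite lamE //; eexists; last by [].
  case: eqP => // xy2; apply: numT; apply: contraTneq axy => xy1.
  by rewrite (_ : x = y) ?twist_adj_irr //; case: x y xy1 xy2 => ? ? [? ?] /= -> ->.
have [u [v [uv <-]]] := Tnum l lT.
(* Over a single point [a] of [W] all vertices are adjacent, so every agreement number occurs on an
   edge. *)
have auv : twist_adj (u, a) (v, a) by rewrite /twist_adj /= xpair_eqE (negPf uv) eqxx.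
by exists ((u, a), (v, a)) => //; rewrite lamE //= eqxx.
Qed.

End Twist.

(** * Arrays over finite fields *)

Section FiniteField.
Variable F : finFieldType.
Local Open Scope ring_scope.

(** These are the parallel classes with slope in [F] or infinite slope: [q+1] rows on [q^k] symbols
    for every [k]. *)
Definition net_row k (i : option F) (a : 'rV[F]_k * 'rV[F]_k) : 'rV[F]_k :=
  if i is Some c then a.1 + c *: a.2 else a.2.

Lemma net_row_inj k (i j : option F) :
  i != j -> injective (fun a : 'rV[F]_k * 'rV[F]_k => (net_row i a, net_row j a)).
Proof.
have mixed c : injective (fun a : 'rV[F]_k * 'rV[F]_k => (a.1 + c *: a.2, a.2)).
  by move=> [a a'] [b b'] /= [+ ab']; rewrite ab' => /addIr ->.
case: i j => [c|] [d|] //= ij [a a'] [b b'] /=.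
- case=> abc abd; have cd : c - d != 0 by rewrite subr_eq0; apply: contra ij => /eqP->.
  have ab' : a' = b'.
    have shift x y : c *: y - d *: y = (x + c *: y) - (x + d *: y) :> 'rV[F]_k.
      by rewrite opprD addrACA subrr add0r.
    by apply: (scalerI cd); rewrite !scalerBl (shift a) (shift b) abc abd.
  by move: abc; rewrite ab' => /addIr ->.
- by case=> ab' abd; apply: (mixed d); rewrite /= abd ab'.
Qed.

Lemma net_row_index k : oa_index (@net_row k) 1.
Proof. by apply: oa_index1_inj; [exact: net_row_inj | rewrite card_prod]. Qed.

(* The [q+1] points of the conic [(1 : c : c^2), (0 : 0 : 1)], as linear forms on [F^3]. *)
Definition conic_row (i : option F) (u : F * F * F) : F :=
  if i is Some c then u.1.1 + c * u.1.2 + c ^+ 2 * u.2 else u.2.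

(** Agreement in a row [Some c] makes [c] a root of a nonzero polynomial of degree at most 2;
    agreement in row [None] kills its leading coefficient and costs one root. *)
Lemma conic_agree u v : u != v -> (num_agree conic_row u v <= 2)%N.
Proof.
case: u v => [[u0 u1] u2] [[v0 v1] v2] uv; rewrite /num_agree.
pose p := Poly [:: u0 - v0; u1 - v1; u2 - v2].
have p_neq0 : p != 0.
  apply: contra uv => /eqP p0; have pi i : p`_i = 0 by rewrite p0 coef0.
  have := pi 0%N; have := pi 1%N; have := pi 2%N; rewrite !coef_Poly /=.
  by move=> /subr0_eq-> /subr0_eq-> /subr0_eq->.
pose rts := [set c | root p c].
have rts_lt : (#|rts| < size p)%N.
  rewrite cardE max_poly_roots ?enum_uniq //.
  by apply/allP => c; rewrite mem_enum inE.
have size_p : (size p <= 2 + (u2 != v2))%N.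
  case: eqVneq => [uv2|_]; last exact: size_Poly.
  apply/leq_sizeP => -[|[|[|j]]] // _; rewrite coef_Poly /=; first by rewrite uv2 subrr.
  by rewrite nth_nil.
have sub : [set i | conic_row i (u0, u1, u2) == conic_row i (v0, v1, v2)]
    \subset (if u2 == v2 then [set None] else set0) :|: Some @: rts.
  apply/subsetP => -[c|]; rewrite !inE /=; last by move=> ->; rewrite inE.
  move=> /eqP cuv; apply/orP; right; apply: imset_f; rewrite inE /root.
  rewrite horner_Poly /=; apply/eqP.
  by rewrite mul0r add0r; transitivity (u0 + c * u1 + c ^+ 2 * u2 - (v0 + c * v1 + c ^+ 2 * v2));
    [ring | rewrite cuv subrr].
apply: leq_trans (subset_leq_card sub) _; apply: leq_trans (leq_card_setU _ _).1 _.
rewrite card_imset; last by move=> ? ? [].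
have := leq_trans rts_lt size_p.
by case: eqP => _ /=; rewrite ?cards1 ?cards0 ?addn0 ?addn1 ?add0n ?add1n !ltnS.
Qed.

Lemma conic_row_inj i j k : uniq [:: i; j; k] ->
  injective (fun u => (conic_row i u, conic_row j u, conic_row k u)).
Proof.
move=> ijk u v [ui uj uk]; apply/eqP; apply: contraT => /conic_agree.
rewrite /num_agree leqNgt => /negP []; rewrite -[3%N]/(size [:: i; j; k]) cardE.
apply: uniq_leq_size => // l; rewrite mem_enum !inE.
by case/or3P => /eqP->; apply/eqP.
Qed.

(* Any two rows extend to three, and three rows determine a point of [F^3]. *)
Lemma conic_row_index : oa_index conic_row #|F|.
Proof.
move=> i j a b ij.
have [k ijk] : exists k, uniq [:: i; j; k].
  have : (0 < #|~: [set i; j]|)%N.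
    rewrite cardsCs setCK cards2 ij card_option.
    by rewrite subn_gt0 ltnS finNzRing_gt1.
  case/card_gt0P => k; rewrite !inE negb_or => /andP [ki kj]; exists k.
  by rewrite /= !inE negb_or ij eq_sym ki eq_sym kj.
rewrite (card_fibres _ (conic_row k)) -[RHS]mul1n -[RHS]mulnC -sum_nat_const.
by apply: eq_bigr => c _; rewrite -(card_fibre_inj (a, b, c) (conic_row_inj ijk)).
Qed.

(* [c^2 + c] takes the value 0 at both 0 and -1, so it is not onto. *)
Lemma exists_no_root : exists d : F, forall c : F, c ^+ 2 + c != d.
Proof.
have [/existsP [d /forallP dP]|] := boolP [exists d : F, [forall c : F, c ^+ 2 + c != d]].
  by exists d.
rewrite negb_exists => /forallP surj.
have onto (d : F) : d \in codom (fun c : F => c ^+ 2 + c).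
  have := surj d; rewrite negb_forall => /existsP [c]; rewrite negbK => /eqP <-.
  exact: codom_f.
have /image_injP inj : #|image (fun c : F => c ^+ 2 + c) F| == #|F|.
  by apply/eqP/eq_card => d; rewrite onto.
have /eqP : (0 : F) = -1.
  by apply: inj => //; rewrite sqrrN expr1n expr0n addr0 subrr.
by rewrite eq_sym oppr_eq0 oner_eq0.
Qed.

Lemma conic_level (Z : finType) : (1 < #|Z|)%N ->
  let T := [:: 0; 1; 2; #|F|.+1]%N in
  let f i (u : F * F * F * Z) := conic_row i u.1 in
  [/\ uniq T, forall u v, u != v -> num_agree f u v \in T
    & forall k, k \in T -> exists u v, u != v /\ num_agree f u v = k].
Proof.
move=> Z1 T f; have F1 := finNzRing_gt1 F.
have /card_gt1P [z [z' [_ _ zz']]] := Z1.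
have full u y y' : num_agree f (u, y) (u, y') = #|F|.+1.
  by rewrite /num_agree /f -card_option; apply: eq_card => i; rewrite !inE eqxx.
split.
- by rewrite /T; case: #|F| F1 => [|[|m]].
- move=> [u y] [v y'] uv; have [<-|/conic_agree] := eqVneq u v.
    by rewrite full !inE eqxx !orbT.
  rewrite -[num_agree f _ _]/(num_agree conic_row u v).
  by case: num_agree => [|[|[|]]].
- have witness u (S : {set option F}) : u != 0 -> (forall i, (conic_row i u == 0) = (i \in S)) ->
      exists u v, u != v /\ num_agree f u v = #|S|.
    move=> u0 uS; exists (u, z), (0, z); rewrite xpair_eqE (negPf u0); split=> //.
    apply: eq_card => i; rewrite !inE -uS /f /=; congr (_ == _).
    by case: i => [c|] //=; rewrite !mulr0 !addr0.
  (* Agreement with the zero vector means incidence with a line. The witnesses are a line missing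
     the conic ([c^2 + c = d] has no solution), a tangent at [None], a secant through [None] and
     [Some 0], and two copies of one column. *)
  move=> k; rewrite !inE => /or4P [] /eqP ->.
  + have [d dP] := exists_no_root; rewrite -(cards0 (option F)).
    apply: (witness (- d, 1, 1)); first by rewrite !xpair_eqE oner_eq0 andbF.
    case=> [c|]; rewrite inE /= ?oner_eq0 // !mulr1 -addrA addrC subr_eq0 addrC.
    by rewrite (negPf (dP c)).
  + rewrite -(cards1 (@None F)); apply: (witness (1, 0, 0)).
      by rewrite !xpair_eqE oner_eq0.
    by case=> [c|]; rewrite inE /= ?eqxx // !mulr0 !addr0 oner_eq0.
  + have <- : #|[set None; Some (0 : F)]| = 2%N by rewrite cards2.
    apply: (witness (0, 1, 0)); first by rewrite !xpair_eqE oner_eq0 andbF.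
    by case=> [c|]; rewrite !inE /= ?eqxx // mulr0 mulr1 addr0 add0r.
  + by exists (0, z), (0, z'); rewrite full xpair_eqE (negPf zz') andbF.
Qed.

End FiniteField.

(** * Existence of the Latin square arrays and conclusion *)

Lemma orthogonal_array_exists (I : finType) (V : finType) (m : nat)
    (g : I -> V * V -> V) :
    (forall i j, i != j -> injective (fun a => (g i a, g j a))) -> #|I| = m ->
  exists A : 'M['I_#|V|]_(m, #|V| ^ 2), orthogonal_array A.
Proof.
move=> gI cI.
have cW : #|V| ^ 2 = #|{: V * V}| by rewrite card_prod.
pose row (i : 'I_m) : I := enum_val (cast_ord (esym cI) i).
pose col (l : 'I_(#|V| ^ 2)) : V * V := enum_val (cast_ord cW l).
exists (\matrix_(i, l) enum_rank (g (row i) (col l)))%R => i j ij l l'.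
rewrite !mxE => -[] /enum_rank_inj gi /enum_rank_inj gj.
have rij : row i != row j.
  by rewrite (inj_eq enum_val_inj) (inj_eq (@cast_ord_inj _ _ _)).
have := gI _ _ rij (col l) (col l'); rewrite gi gj => /(_ erefl).
by move/enum_val_inj/cast_ord_inj.
Qed.

Theorem theorem5p14 (q s : nat) (hq : prime_power q) (hs : 2 <= s)
    (hqs : q %| s) (hneq : s <> q) :
  forall n0 : nat, exists n : nat,
    n0 < n /\
    (exists A : 'M['I_(q * n)]_(q + 1, (q * n) ^ 2), orthogonal_array A) /\
    exists G : sgraph,
      co_edge_regular G /\ has_level G 4 /\
      forall A : 'M['I_(q * n)]_(q + 1, (q * n) ^ 2), orthogonal_array A ->
        cospectral G (clique_extension s (latin_square_graph A)).
Proof.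
move=> n0; case: hq => p [e [p_pr e_gt0 qE]].
have [F _ cF] := pPrimePowerField p_pr e_gt0; rewrite -qE in cF.
have q_gt1 : 1 < q by rewrite -cF; exact: finNzRing_gt1.
have q_gt0 : 0 < q by apply: ltnW.
have s_gt0 : 0 < s by apply: ltnW.
have [r sE] := dvdnP hqs.
(* The conic array has index [q], so [r] copies of each column give index [s]; [r > 1] provides the
   repeated columns behind the fourth value. *)
have r_gt1 : 1 < r.
  by case: r sE => [|[|r]] // sE; [rewrite sE in hs | case: hneq; rewrite sE mul1n].
(* For a power of [q], vector spaces over [F] supply symbol sets of sizes [n] and [q n]. *)
pose n := q ^ n0.+1.
have n_gt0 : n0 < n by apply: leq_trans (ltn_expl _ q_gt1).
have n_gt1 : 1 < n by rewrite -(expn0 q) ltn_exp2l.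
have cV k : #|{: 'rV[F]_k}| = q ^ k by rewrite card_mx mul1n cF.
have cI : #|{: option F}| = q.+1 by rewrite card_option cF.
exists n; split=> //; split.
  have cN : #|{: 'rV[F]_n0.+2}| = q * n by rewrite cV expnS.
  rewrite -cN; apply: (orthogonal_array_exists (@net_row_inj F _)).
  by rewrite cI addn1.
pose f (i : option F) (u : F * F * F * 'I_r) := conic_row i u.1.
have fP : oa_index f s.
  have := @oa_index_copies _ _ _ 'I_r _ _ (@conic_row_index F).
  by rewrite card_ord cF mulnC -sE.
pose h := @net_row F n0.+1.
have hP : oa_index h 1 := @net_row_index F n0.+1.
have cZ : #|{: 'rV[F]_n0.+1}| = n := cV _.
exists (twist f h); split; first exact: (twist_co_edge_regular fP hP cI cF cZ).
split.
  have [|uT numT Tnum] := @conic_level F 'I_r; first by rewrite card_ord.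
  apply: (twist_level fP hP cI cF cZ q_gt0 s_gt0 n_gt1 _ _ uT _ numT Tnum) => //.
    by rewrite card_prod cZ muln_gt0 (ltnW n_gt1).
  by rewrite (leq_trans hs) // leq_pmulr // expn_gt0 q_gt0.
move=> A AP a; rewrite /eig_mult.
have nG := twist_net_like fP hP cI cF cZ q_gt0 s_gt0.
have nH := clique_extension_net_like AP q_gt0 s_gt0.
apply: (net_like_mup a s_gt0 q_gt0 _ _ nG nH).
  by rewrite -{1}[q]muln1 ltn_pmul2l.
(* Both graphs have [q^3 r n^2] vertices. *)
rewrite !card_prod !card_ord cF cZ sE expnMn; lia.
Qed.
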